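(* There exists a cubic graph of order $78$ that contains no cycle of length $4$, $8$ or $16$ (equivalently, no cycle of length $2^m$ for any $m \leq 4$). Consequently $f(4) \leq 78$.
   Context: Graphs are finite and simple (no loops or multiple edges). A graph is cubic if every vertex has degree $3$; the order of a graph is its number of vertices. A cycle of length $n$ (an $n$-cycle) is a subgraph isomorphic to the $n$-cycle, not necessarily induced. For an integer $k \geq 2$, $f(k)$ denotes the smallest order of a cubic graph with no $2^m$-cycles for all $m \leq k$ (since graphs are simple, only $m \geq 2$ is relevant). *)

(* Defs.v *)
From mathcomp Require Import all_boot.

Set Implicit Arguments.
Unset Strict Implicit.
Unset Printing Implicit Defensive.

(* The vertex set is required to be nonempty: the empty graph is vacuously
   cubic and would make f(k) equal to 0. *)
Record sgraph := SGraph {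
  vertex :> finType;
  adj : rel vertex;
  adj_sym : symmetric adj;
  adj_irrefl : irreflexive adj;
  vertex_gt0 : 0 < #|vertex|
}.

Arguments adj : clear implicits.

Definition graph_order (G : sgraph) : nat := #|G|.

Definition degree (G : sgraph) (x : G) : nat := #|[set y | adj G x y]|.

Definition cubic (G : sgraph) : Prop := forall x : G, degree x = 3.

(* The bound 2 < n is needed because ucycle also accepts the empty sequence
   and, for adjacent x and y, the sequence [:: x; y], neither of which is a
   cycle of a simple graph. *)
Definition has_cycle (G : sgraph) (n : nat) : Prop :=
  2 < n /\ exists c : n.-tuple G, ucycle (adj G) c.

Definition no_pow2_cycle (k : nat) (G : sgraph) : Prop :=
  forall m : nat, m <= k -> ~ has_cycle G (2 ^ m).

(* is_f k n states that f(k) exists and equals n; such an n is unique. *)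
Definition is_f (k n : nat) : Prop :=
  (exists G : sgraph, [/\ cubic G, no_pow2_cycle k G & graph_order G = n]) /\
  (forall G : sgraph, cubic G -> no_pow2_cycle k G -> n <= graph_order G).

(* Main.v *)
Require Import Defs.
From mathcomp Require Import all_boot.
From Stdlib Require Import Classical.

Set Implicit Arguments.
Unset Strict Implicit.
Unset Printing Implicit Defensive.

(** The graph of order 78 is the Petersen graph with each vertex replaced by a
    three-legged gadget: nine vertices by a gadget of order 7 and one by a
    gadget of order 15, neither containing a 4- or an 8-cycle.
    A path through the 7-gadget visits at least 3 vertices, and at least 4 for
    one of the three pairs of legs; a path through the 15-gadget visits at
    least 4.  Cycles of the Petersen graph of length at least 6 thus give
    cycles of length at least 18, and the gadgets are oriented so that the
    cycles coming from 5-cycles have length at least 17.  Every cycle inside a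
    gadget has length at most 15.  The absence of 4-, 8- and 16-cycles is
    confirmed by an exhaustive search. *)

(* The first block of rows is the 15-gadget, the others are the 7-gadgets. *)
Definition nbrs : seq (seq nat) :=
  [::
   [:: 1; 2; 61]; [:: 0; 3; 4]; [:: 0; 5; 6]; [:: 1; 4; 5]; [:: 1; 3; 7];
   [:: 2; 3; 6]; [:: 2; 5; 8]; [:: 4; 9; 10]; [:: 6; 11; 68]; [:: 7; 10; 12];
   [:: 7; 9; 13]; [:: 8; 12; 14]; [:: 9; 11; 14]; [:: 10; 14; 75]; [:: 11; 12; 13];

   [:: 16; 17; 43]; [:: 15; 17; 18]; [:: 15; 16; 19]; [:: 16; 20; 21]; [:: 17; 20; 54];
   [:: 18; 19; 21]; [:: 18; 20; 71];

   [:: 23; 24; 36]; [:: 22; 24; 25]; [:: 22; 23; 26]; [:: 23; 27; 28]; [:: 24; 27; 50];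
   [:: 25; 26; 28]; [:: 25; 27; 64];

   [:: 30; 31; 47]; [:: 29; 31; 32]; [:: 29; 30; 33]; [:: 30; 34; 35]; [:: 31; 34; 40];
   [:: 32; 33; 35]; [:: 32; 34; 57];

   [:: 22; 37; 38]; [:: 36; 38; 39]; [:: 36; 37; 40]; [:: 37; 41; 42]; [:: 33; 38; 41];
   [:: 39; 40; 42]; [:: 39; 41; 77];

   [:: 15; 44; 45]; [:: 43; 45; 46]; [:: 43; 44; 47]; [:: 44; 48; 49]; [:: 29; 45; 48];
   [:: 46; 47; 49]; [:: 46; 48; 70];

   [:: 26; 51; 52]; [:: 50; 52; 53]; [:: 50; 51; 54]; [:: 51; 55; 56]; [:: 19; 52; 55];
   [:: 53; 54; 56]; [:: 53; 55; 63];

   [:: 35; 58; 59]; [:: 57; 59; 60]; [:: 57; 58; 61]; [:: 58; 62; 63]; [:: 0; 59; 62];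
   [:: 60; 61; 63]; [:: 56; 60; 62];

   [:: 28; 65; 66]; [:: 64; 66; 67]; [:: 64; 65; 68]; [:: 65; 69; 70]; [:: 8; 66; 69];
   [:: 67; 68; 70]; [:: 49; 67; 69];

   [:: 21; 72; 73]; [:: 71; 73; 74]; [:: 71; 72; 75]; [:: 72; 76; 77]; [:: 13; 73; 76];
   [:: 74; 75; 77]; [:: 42; 74; 76]].

Definition nb (x : nat) : seq nat := nth [::] nbrs x.

Section CycleSearch.

Variable u : nat.

Definition walk_step (r : bitseq) : bitseq := [seq has (nth false r) l | l <- nbrs].

Definition root_mask : bitseq := mkseq (eq_op u) (size nbrs).

(* The j-th mask from the end marks the vertices from which a walk with j
   edges leads to u (counting from j = 1). *)
Fixpoint walk_masks (k : nat) : seq bitseq :=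
  if k is k'.+1 then
    let ms := walk_masks k' in walk_step (head root_mask ms) :: ms
  else [::].

(* The last mask already says that the final vertex is adjacent to u, hence
   the value true on the empty list.  The conditional is not written with &&,
   which vm_compute would evaluate strictly, losing the pruning. *)
Fixpoint cycle_search (ms : seq bitseq) (visited : seq nat) (x : nat) : bool :=
  if ms is m :: ms' then
    has (fun y => if nth false m y && (y \notin visited)
                  then cycle_search ms' (y :: visited) y else false) (nb x)
  else true.

Lemma nth_walk_step r x : nth false (walk_step r) x = has (nth false r) (nb x).
Proof.
rewrite /walk_step /nb; have [lt_x|le_x] := ltnP x (size nbrs).
  by rewrite (nth_map [::]).
by rewrite !nth_default // size_map.
Qed.

Lemma walk_masksP x p :
  u < size nbrs -> path (fun x y => y \in nb x) x p -> u \in nb (last x p) ->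
  nth false (head root_mask (walk_masks (size p).+1)) x.
Proof.
move=> lt_u; elim: p x => [|y p IHp] x.
  move=> _ /= ux; rewrite nth_walk_step; apply/hasP; exists u => //.
  by rewrite nth_mkseq //=.
case/andP=> xy yp up; rewrite [walk_masks _]/= [head _ (_ :: _)]/= nth_walk_step.
by apply/hasP; exists y => //; apply: IHp.
Qed.

(** Pruning loses no cycle: each vertex of [p] starts a walk along the rest of [p] and back to [u],
    so by [walk_masksP] it passes its mask. A failed search therefore refutes cycles through [u]. *)
Lemma cycle_searchP visited x p :
  u < size nbrs -> path (fun x y => y \in nb x) x p -> u \in nb (last x p) ->
  uniq p -> ~~ has (mem visited) p ->
  cycle_search (walk_masks (size p)) visited x.
Proof.
move=> lt_u; elim: p x visited => [|y p IHp] x visited //.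
case/andP=> xy yp up /= /andP[y'p Up] /norP[y'v p'v].
apply/hasP; exists y => //; rewrite (walk_masksP lt_u yp up) y'v /=.
apply: IHp => //; apply/hasPn=> z zp; rewrite inE negb_or.
by rewrite (hasPn p'v) // andbT; apply: contraNneq y'p => <-.
Qed.

End CycleSearch.

(** The root is already placed and the last mask accounts for the closing edge, hence [n.-1]
    masks. *)
Definition search_all (n : nat) : bool :=
  has (fun u => cycle_search (walk_masks u n.-1) [:: u] u) (iota 0 (size nbrs)).

Definition adj78 : rel 'I_78 := fun x y => val y \in nb x.

Lemma size_nbrs : size nbrs = 78. Proof. by []. Qed.

Lemma nb_sym x y : x \in nb y -> y \in nb x.
Proof.
have tab : all (fun i => all (fun j => i \in nb j) (nb i)) (iota 0 78).
  by vm_compute.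
(* Rows beyond the table default to [[::]], so [xy] forces [y] into range. *)
move=> xy; have lt_y : y < 78.
  by rewrite ltnNge; apply/negP=> le_y; move: xy; rewrite /nb nth_default.
have /(allP tab)/allP/(_ _ xy) // : y \in iota 0 78 by rewrite mem_iota.
Qed.

Lemma adj78_sym : symmetric adj78.
Proof. by move=> x y; apply/idP/idP; apply: nb_sym. Qed.

Lemma adj78_irrefl : irreflexive adj78.
Proof.
have tab : all (fun i => i \notin nb i) (iota 0 78) by vm_compute.
move=> x; apply/negbTE/(allP tab).
by rewrite mem_iota ltn_ord.
Qed.

Lemma card_ord78_gt0 : 0 < #|'I_78|. Proof. by rewrite card_ord. Qed.

Definition G78 : sgraph := SGraph adj78_sym adj78_irrefl card_ord78_gt0.

Lemma G78_cubic : cubic G78.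
Proof.
(* Counting vertices that occur in a row, instead of measuring the row, gives the cardinal of the
   neighbour set directly. *)
have tab : all (fun i => count (mem (nb i)) (iota 0 78) == 3) (iota 0 78).
  by vm_compute.
move=> x; rewrite /degree cardsE cardE size_filter -enumT.
have /(allP tab)/eqP count_x : val x \in iota 0 78 by rewrite mem_iota ltn_ord.
rewrite -[RHS]count_x -val_enum_ord [RHS]count_map.
by apply: eq_count => y.
Qed.

Lemma G78_no_cycle n : ~~ search_all n -> ~ has_cycle G78 n.
Proof.
move/hasPn=> no_cycle [n_gt2 [[c /= /eqP sz_c]]].
case: c sz_c => [|x p] /= sz_p; first by rewrite -sz_p in n_gt2.
rewrite /ucycle /= rcons_path => /andP[/andP[xp px] /andP[x'p Up]].
have lt_x : val x < size nbrs by rewrite size_nbrs ltn_ord.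
have /no_cycle/negP[] : val x \in iota 0 (size nbrs) by rewrite mem_iota.
rewrite -sz_p /= -(size_map val); apply: cycle_searchP => //.
- by rewrite path_map.
- by rewrite last_map.
- by rewrite map_inj_uniq //; apply: val_inj.
apply/hasPn=> y /mapP[z zp ->]; rewrite /= inE.
by apply: contraNneq x'p => /val_inj <-.
Qed.

Lemma no_cycle4 : ~~ search_all 4. Proof. by vm_compute. Qed.
Lemma no_cycle8 : ~~ search_all 8. Proof. by vm_compute. Qed.
Lemma no_cycle16 : ~~ search_all 16. Proof. by vm_compute. Qed.

Lemma no_pow2_cycle4E (G : sgraph) :
  [/\ ~ has_cycle G 4, ~ has_cycle G 8 & ~ has_cycle G 16]
  <-> no_pow2_cycle 4 G.
Proof.
split=> [[no4 no8 no16] | no_pow2].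
  (* Exponents 0 and 1 give lengths 1 and 2, excluded by the bound in [has_cycle]. *)
  by case=> [|[|[|[|[|m]]]]] // _; case.
by split; [apply: (no_pow2 2) | apply: (no_pow2 3) | apply: (no_pow2 4)].
Qed.

(** Strong induction with excluded middle, since [P] will be the existence of a graph of given
    order, which is not a boolean predicate. *)
Lemma ex_least (P : nat -> Prop) n :
  P n -> exists m, [/\ P m, m <= n & forall k, P k -> m <= k].
Proof.
elim/ltn_ind: n => n IHn Pn.
have [[k [lt_kn Pk]] | least_n] := classic (exists k, k < n /\ P k).
  have [m [Pm le_mk least_m]] := IHn k lt_kn Pk.
  by exists m; split=> //; apply: leq_trans le_mk (ltnW lt_kn).
exists n; split=> // k Pk; rewrite leqNgt; apply/negP=> lt_kn.
by apply: least_n; exists k.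
Qed.

Theorem mainTheorem2 :
  [/\ exists G : sgraph,
        [/\ cubic G, graph_order G = 78,
            ~ has_cycle G 4, ~ has_cycle G 8 & ~ has_cycle G 16],
      forall G : sgraph,
        [/\ ~ has_cycle G 4, ~ has_cycle G 8 & ~ has_cycle G 16]
        <-> no_pow2_cycle 4 G
    & exists2 n : nat, is_f 4 n & n <= 78].
Proof.
have order78 : graph_order G78 = 78 by rewrite /graph_order card_ord.
have no4 := G78_no_cycle no_cycle4.
have no8 := G78_no_cycle no_cycle8.
have no16 := G78_no_cycle no_cycle16.
split; first by exists G78; split=> //; apply: G78_cubic.
  exact: no_pow2_cycle4E.
pose P n := exists G, [/\ cubic G, no_pow2_cycle 4 G & graph_order G = n].
have P78 : P 78.
  by exists G78; split=> //; [apply: G78_cubic | apply/no_pow2_cycle4E].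
have [m [Pm le_m least_m]] := ex_least P78.
exists m => //; split=> // G cubicG no_pow2G.
by apply: least_m; exists G.
Qed.
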